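(* Every planar $3$-tree is an $\{\llcorner\}$-graph.
   Context: All graphs are finite and simple. A $3$-tree is an edge-maximal graph of treewidth $3$; equivalently, a graph that can be built starting from the complete graph $K_4$ by repeatedly adding a new vertex whose neighborhood in the graph constructed so far is a triangle (a clique on $3$ vertices). A planar $3$-tree is a $3$-tree that is planar. An axis-aligned L-shape is the union of a horizontal and a vertical segment in the plane whose intersection is an endpoint of both. An L-shape of rotation $\llcorner$ is one in which the common endpoint is the lower endpoint of the vertical segment and the left endpoint of the horizontal segment. A graph $G$ is an $\{\llcorner\}$-graph if one can assign to each vertex of $G$ an L-shape of rotation $\llcorner$ in the plane such that two distinct vertices are adjacent in $G$ if and only if their L-shapes intersect. *)

(* Defs.v *)
From mathcomp Require Import all_boot.
From Stdlib Require Import Reals.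

Set Implicit Arguments.
Unset Strict Implicit.
Unset Printing Implicit Defensive.

Definition simple_graph (T : finType) (adj : rel T) : Prop :=
  (forall x y, adj x y = adj y x) /\ (forall x, adj x x = false).

(** * 3-trees.  A graph is a 3-tree if its vertices can be listed as
    s_0, s_1, ..., s_{n-1} (every vertex exactly once) such that
    s_0..s_3 induce a K4, and for each i >= 4 the neighbours of s_i among
    s_0..s_{i-1} are exactly three vertices forming a triangle.  This is
    literally the construction "start from K4 and repeatedly add a new vertex
    whose neighbourhood in the graph built so far is a triangle". *)
Definition is_clique (T : finType) (adj : rel T) (A : seq T) : Prop :=
  forall x y, x \in A -> y \in A -> x != y -> adj x y.

Definition three_tree (T : finType) (adj : rel T) : Prop :=
  simple_graph adj /\
  exists s : seq T,
    [/\ uniq s, (forall x : T, x \in s), 4 <= size s,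
        is_clique adj (take 4 s) &
        forall (i : nat) (x0 : T), 4 <= i < size s ->
          let nb := [seq y <- take i s | adj (nth x0 s i) y] in
          size nb = 3 /\ is_clique adj nb].

Local Open Scope R_scope.

Definition point := (R * R)%type.

Definition continuous_on01 (g : R -> point) : Prop :=
  forall t, 0 <= t <= 1 -> forall eps, 0 < eps -> exists delta, 0 < delta /\
    forall s, 0 <= s <= 1 -> Rabs (s - t) < delta ->
      Rabs (fst (g s) - fst (g t)) < eps /\ Rabs (snd (g s) - snd (g t)) < eps.

Definition injective_on01 (g : R -> point) : Prop :=
  forall s t, 0 <= s <= 1 -> 0 <= t <= 1 -> g s = g t -> s = t.

Definition planar (T : finType) (adj : rel T) : Prop :=
  exists (pos : T -> point) (arc : T -> T -> R -> point),
    (forall u v, pos u = pos v -> u = v) /\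
    (forall u v, adj u v ->
       [/\ continuous_on01 (arc u v), injective_on01 (arc u v),
           arc u v 0 = pos u, arc u v 1 = pos v &
           forall t w, 0 < t < 1 -> arc u v t <> pos w]) /\
    (forall u v u' v', adj u v -> adj u' v' ->
       ~ ((u = u' /\ v = v') \/ (u = v' /\ v = u')) ->
       forall s t, 0 < s < 1 -> 0 < t < 1 -> arc u v s <> arc u' v' t).

Definition planar_three_tree (T : finType) (adj : rel T) : Prop :=
  three_tree adj /\ planar adj.

(** * L-shapes of rotation "└": corner (x,y), vertical segment going up from the
    corner with length h > 0, horizontal segment going right with length w > 0. *)
Record Lshape := { Lx : R; Ly : R; Lh : R; Lw : R }.

Definition Lshape_valid (L : Lshape) : Prop := 0 < Lh L /\ 0 < Lw L.

Definition in_Lshape (L : Lshape) (p : point) : Prop :=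
  (fst p = Lx L /\ Ly L <= snd p <= Ly L + Lh L) \/
  (snd p = Ly L /\ Lx L <= fst p <= Lx L + Lw L).

Definition Lshapes_intersect (L1 L2 : Lshape) : Prop :=
  exists p, in_Lshape L1 p /\ in_Lshape L2 p.

Definition is_L_graph (T : finType) (adj : rel T) : Prop :=
  exists f : T -> Lshape,
    (forall v, Lshape_valid (f v)) /\
    (forall u v, u <> v -> (adj u v <-> Lshapes_intersect (f u) (f v))).

(* Main.v *)
Require Import Defs.
From Coquelicot Require Import Compactness Rcomplements.
From Stdlib Require Import Reals Lra Classical IndefiniteDescription.
From Stdlib Require Import FunctionalExtensionality PropExtensionality.
From mathcomp Require Import all_boot.

(** Planarity enters only through K_{3,3}: a triangle of a planar graph has at most
    two common neighbours, so in the stacking construction every new vertex is put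
    into a triangle that still bounds a face.  The L-representation grows along with
    the graph: each face [{a, b, c}] keeps a private region of the plane which meets
    only the shapes of [a], [b] and [c], in one of a few fixed patterns; the new
    L-shape is drawn inside that region and leaves room there for three disjoint
    private regions, one for each new face.

    K_{3,3} is shown to be non-planar without the Jordan curve theorem.  For two
    disjoint edges [e] and [f] the vector [f(t) - e(s)] never vanishes on the unit
    square, so its mod-2 winding number along the boundary is zero.  This is a linear
    equation over F_2 between the winding numbers of edges as seen from vertices,
    and the sum of these equations over all pairs of disjoint edges is [0 = 1]. *)

Set Implicit Arguments.
Unset Strict Implicit.
Unset Printing Implicit Defensive.

(** * Non-planarity of K_{3,3} *)

Local Open Scope nat_scope.

(* One equation for each of the 18 pairs of disjoint edges [a_i b_j], [a_k b_l] of
   K_{3,3}: in their sum every [KA], [KB] and every entry of [aa], [ba], [ab] occurs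
   an even number of times, whereas the [bb] terms form nine pairs
   [bb j l + bb l j = 1]. *)
Lemma K33_parity (KA KB : nat -> nat -> nat -> bool)
    (aa ba ab bb : nat -> nat -> bool) :
  (forall j l, j <> l -> bb j l = ~~ bb l j) ->
  (forall i j k l, (i < k < 3)%N -> (j < 3)%N -> (l < 3)%N -> j <> l ->
    KA i k l (+) KB j k l = (KA k i j (+) (aa i k (+) ba j k))
      (+) (KB l i j (+) (ab i l (+) bb j l))) ->
  False.
Proof.
move=> anti eqn.
have addbE (x y : bool) : x (+) y = xorb x y by case: x; case: y.
have negE (x : bool) : ~~ x = xorb true x by [].
have := eqn 0 0 1 1; have := eqn 0 0 1 2; have := eqn 0 1 1 0.
have := eqn 0 1 1 2; have := eqn 0 2 1 0; have := eqn 0 2 1 1.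
have := eqn 0 0 2 1; have := eqn 0 0 2 2; have := eqn 0 1 2 0.
have := eqn 0 1 2 2; have := eqn 0 2 2 0; have := eqn 0 2 2 1.
have := eqn 1 0 2 1; have := eqn 1 0 2 2; have := eqn 1 1 2 0.
have := eqn 1 1 2 2; have := eqn 1 2 2 0; have := eqn 1 2 2 1.
rewrite (anti 1 0) // (anti 2 0) // (anti 2 1) // !addbE !negE.
do 18! (move=> /(_ isT isT isT); move=> /(_ (fun e => ltac:(discriminate e))); move=> ?).
have add_eqn (x y u v : bool) : x = y -> xorb x u = xorb y v -> u = v.
  by move=> -> ; case: y; case: u; case: v.
(* Each equation is added to both sides of [false = true]; the result is a polynomial identity over
   F_2. *)
suff : false = true by [].
do 18! (match goal with E : _ = _ |- _ => apply: (add_eqn _ _ _ _ E); clear E end).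
ring.
Qed.

(** * Axis crossings and mod-2 winding numbers *)

Local Open Scope R_scope.

Definition psub (p q : point) : point := (p.1 - q.1, p.2 - q.2).

(* The tie-break on the axis makes [lower] take opposite values at [p] and [- p]
   for every [p <> 0]. *)
Definition lower (p : point) : bool :=
  if Rlt_dec p.2 0 then true
  else if Rlt_dec 0 p.2 then false
  else if Rlt_dec p.1 0 then true else false.

Definition rightward (p : point) : bool := if Rlt_dec 0 p.1 then true else false.

(* For [p] and [q] in a common [same_side] set: whether the step from [p] to [q]
   crosses the positive half of the x-axis. *)
Definition crossing (p q : point) : bool := (lower p (+) lower q) && rightward p.

(** These four open half-planes cover the plane minus the origin, so a small piece of a curve that
    avoids the origin lies in one of them. *)
Definition same_side (S : point -> Prop) : Prop :=
  [\/ forall p, S p -> 0 < p.1, forall p, S p -> p.1 < 0,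
      forall p, S p -> 0 < p.2 | forall p, S p -> p.2 < 0].

Lemma lower_sub p q : p <> q -> lower (psub p q) = ~~ lower (psub q p).
Proof.
case: p q => [px py] [qx qy] npq; rewrite /lower /=.
repeat case: Rlt_dec => ? //=; try lra.
by case: npq; congr pair; lra.
Qed.

(** In the right half-plane [crossing p q] is [lower p (+) lower q], and in the other three it
    vanishes; either way the four edges of a cell sum to zero. *)
Lemma crossing_square S p q r s : same_side S -> S p -> S q -> S r -> S s ->
  crossing p q (+) crossing r s = crossing p r (+) crossing q s.
Proof.
move=> side Sp Sq Sr Ss; rewrite /crossing.
case: side => side; have := (side _ Sp, side _ Sq, side _ Sr, side _ Ss).
- move=> [[[xp xq] xr] xs]; rewrite /rightward; repeat case: Rlt_dec => ? //=; try lra.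
  by rewrite !andbT; case: (lower p); case: (lower q); case: (lower r); case: (lower s).
- move=> [[[xp xq] xr] xs]; rewrite /rightward; repeat case: Rlt_dec => ? //=; try lra.
  by rewrite !andbF.
- by move=> [[[xp xq] xr] xs]; rewrite /lower; repeat case: Rlt_dec => ? //=; try lra.
- by move=> [[[xp xq] xr] xs]; rewrite /lower; repeat case: Rlt_dec => ? //=; try lra.
Qed.

(** The antipodal step crosses the positive x-axis where the original one crosses the negative half;
    together these crossings are the changes of [lower]. *)
Lemma crossing_antipode S p q v :
  same_side S -> S (psub p v) -> S (psub q v) ->
  crossing (psub v p) (psub v q) =
  crossing (psub p v) (psub q v) (+) (lower (psub p v) (+) lower (psub q v)).
Proof.
case: p q v => [px py] [qx qy] [vx vy] side Sp Sq.
case: side => side; move: (side _ Sp) (side _ Sq) => /=;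
  rewrite /crossing /lower /rightward /= => ? ?; repeat case: Rlt_dec => ? //=; lra.
Qed.

(** A discrete Stokes formula: when [crossing_square] is summed over all cells, every interior edge
    occurs twice and cancels. *)
Lemma grid_boundary (G : nat -> nat -> point) (N : nat) :
  (forall i j : nat, (i < N)%N -> (j < N)%N -> exists S, [/\ same_side S, S (G i j),
      S (G i.+1 j), S (G i j.+1) & S (G i.+1 j.+1)]) ->
  \big[addb/false]_(0 <= j < N) crossing (G 0%N j) (G 0%N j.+1) (+)
  \big[addb/false]_(0 <= j < N) crossing (G N j) (G N j.+1) =
  \big[addb/false]_(0 <= i < N) crossing (G i 0%N) (G i.+1 0%N) (+)
  \big[addb/false]_(0 <= i < N) crossing (G i N) (G i.+1 N).
Proof.
move=> cell.
have row (i M : nat) : (i < N)%N -> (M <= N)%N ->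
  \big[addb/false]_(0 <= j < M) crossing (G i j) (G i j.+1) (+)
  \big[addb/false]_(0 <= j < M) crossing (G i.+1 j) (G i.+1 j.+1) =
  crossing (G i 0%N) (G i.+1 0%N) (+) crossing (G i M) (G i.+1 M).
  move=> iN; elim: M => [|M IH] MN; first by rewrite !big_geq //= addbb.
  rewrite !big_nat_recr //= addbACA IH ?(ltnW MN) //.
  have [S [side ? ? ? ?]] := cell _ _ iN MN.
  rewrite (crossing_square (p := G i M) (q := G i M.+1) side) //.
  by rewrite -addbA addKb.
suff gen (M : nat) : (M <= N)%N ->
  \big[addb/false]_(0 <= j < N) crossing (G 0%N j) (G 0%N j.+1) (+)
  \big[addb/false]_(0 <= j < N) crossing (G M j) (G M j.+1) =
  \big[addb/false]_(0 <= i < M) crossing (G i 0%N) (G i.+1 0%N) (+)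
  \big[addb/false]_(0 <= i < M) crossing (G i N) (G i.+1 N) by exact: gen.
elim: M => [|M IH] MN; first by rewrite addbb !big_geq.
rewrite !(big_nat_recr M) //= addbACA -(row M N) // -IH ?(ltnW MN) //.
by rewrite -addbA addKb.
Qed.

Definition node (N k : nat) : R := INR k / INR N.

(** The mod-2 winding number of [e] seen from [v], sampled at [N + 1] nodes; it is meaningful once
    consecutive nodes lie in a common half-plane. *)
Definition turning (N : nat) (v : point) (e : R -> point) : bool :=
  \big[addb/false]_(0 <= j < N)
    crossing (psub (e (node N j)) v) (psub (e (node N j.+1)) v).

Lemma node_bounds N k : (0 < N)%N -> (k <= N)%N -> 0 <= node N k <= 1.
Proof.
move=> /ltP/lt_INR /= N0 /leP/le_INR kN; rewrite /node.
split; first by apply: Rdiv_le_0_compat => //; exact: pos_INR.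
by apply/Rle_div_l => //; lra.
Qed.

(** A Lebesgue number argument: [f t - e s] never vanishes, so near each point of the square it
    stays in a half-plane, and compactness makes the scale uniform. *)
Lemma fine_grid (e f : R -> point) : continuous_on01 e -> continuous_on01 f ->
  (forall s t, 0 <= s <= 1 -> 0 <= t <= 1 -> e s <> f t) ->
  exists N0 : nat, forall N : nat, (N0 < N)%N -> forall i j : nat, (i < N)%N -> (j < N)%N ->
    exists S : point -> Prop, same_side S /\
      forall i' j' : nat, (i <= i' <= i.+1)%N -> (j <= j' <= j.+1)%N ->
        S (psub (f (node N j')) (e (node N i'))).
Proof.
move=> ce cf dis.
(* The factor 2 covers two displacements: from the centre to a node, then to another node of the
   same cell. *)
have loc (w : R * R) : exists d : posreal, 0 <= w.1 <= 1 -> 0 <= w.2 <= 1 ->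
    same_side (fun p => exists s t, [/\ 0 <= s <= 1, 0 <= t <= 1,
      Rabs (s - w.1) < 2 * d, Rabs (t - w.2) < 2 * d & p = psub (f t) (e s)]).
  case: w => u v /=.
  case: (classic (0 <= u <= 1 /\ 0 <= v <= 1)) => [[u01 v01]|n01]; last first.
    by exists (mkposreal 1 Rlt_0_1) => ? ?; case: n01.
  (* Half the sup norm: [e] and [f] each move by less than [eps], so the dominant coordinate of the
     difference keeps its sign. *)
  set eps := Rmax (Rabs (fst (f v) - fst (e u))) (Rabs (snd (f v) - snd (e u))) / 2.
  have eps0 : 0 < eps.
    rewrite /eps.
    suff : 0 < Rmax (Rabs (fst (f v) - fst (e u))) (Rabs (snd (f v) - snd (e u))) by lra.
    apply: Rnot_le_lt => le0; apply: (dis u v) => //.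
    have := Rmax_l (Rabs (fst (f v) - fst (e u))) (Rabs (snd (f v) - snd (e u))).
    have := Rmax_r (Rabs (fst (f v) - fst (e u))) (Rabs (snd (f v) - snd (e u))).
    case: (e u) (f v) le0 => [x y] [x' y'] /= ? ? ?.
    by congr pair; split_Rabs; lra.
  have [d1 [d10 H1]] := ce _ u01 _ eps0.
  have [d2 [d20 H2]] := cf _ v01 _ eps0.
  have d0 : 0 < Rmin d1 d2 / 2.
    by have := Rmin_pos _ _ d10 d20; lra.
  exists (mkposreal _ d0) => _ _ /=.
  have key s t : 0 <= s <= 1 -> 0 <= t <= 1 -> Rabs (s - u) < 2 * (Rmin d1 d2 / 2) ->
     Rabs (t - v) < 2 * (Rmin d1 d2 / 2) ->
     Rabs (fst (psub (f t) (e s)) - (fst (f v) - fst (e u))) < 2 * eps /\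
     Rabs (snd (psub (f t) (e s)) - (snd (f v) - snd (e u))) < 2 * eps.
    move=> s01 t01 su tv.
    have l1 := Rmin_l d1 d2; have l2 := Rmin_r d1 d2.
    have [] := H1 _ s01 ltac:(lra); have [] := H2 _ t01 ltac:(lra).
    by rewrite /psub /=; split_Rabs; lra.
  have : 2 * eps = Rabs (fst (f v) - fst (e u)) \/ 2 * eps = Rabs (snd (f v) - snd (e u)).
    by rewrite /eps /Rmax; case: Rle_dec => _; [right|left]; lra.
  case=> Heps.
  - case: (Rle_lt_dec 0 (fst (f v) - fst (e u))) => sg; [constructor 1|constructor 2];
    by move=> _ [s [t [s01 t01 su tv ->]]]; have [k1 k2] := key _ _ s01 t01 su tv;
      move: k1 Heps; split_Rabs; lra.
  - case: (Rle_lt_dec 0 (snd (f v) - snd (e u))) => sg; [constructor 3|constructor 4];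
    by move=> _ [s [t [s01 t01 su tv ->]]]; have [k1 k2] := key _ _ s01 t01 su tv;
      move: k2 Heps; split_Rabs; lra.
have [delta Hdelta] := functional_choice _ loc.
have [d Hd] := compactness_value_2d 0 1 0 1 (fun u v => delta (u, v)).
have [N0 [HN0 N00]] := archimed_cor1 d (cond_pos d).
exists N0 => N ltN i j iN jN.
have N_pos : (0 < N)%N by apply: leq_ltn_trans ltN.
have NR : 0 < INR N by apply: lt_0_INR; apply/ltP.
have dN : / INR N < d.
  apply: Rlt_trans HN0; apply: Rinv_lt_contravar; last by apply: lt_INR; apply/ltP.
  by apply: Rmult_lt_0_compat => //; apply: lt_0_INR.
have nb (k : nat) : (k <= N)%N -> 0 <= node N k <= 1 by exact: node_bounds.
have step (k k' : nat) : (k <= k' <= k.+1)%N -> Rabs (node N k' - node N k) < d.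
  case/andP=> kk' k'k; have : k' = k \/ k' = k.+1.
    by move: kk'; rewrite leq_eqVlt => /orP[/eqP <-|lt]; [left|right; apply/eqP; rewrite eqn_leq k'k lt].
  have d0 := cond_pos d.
  case=> ->; first by rewrite Rminus_diag Rabs_R0.
  rewrite /node S_INR.
  have -> : (INR k + 1) / INR N - INR k / INR N = / INR N by field; lra.
  by rewrite Rabs_pos_eq //; left; apply: Rinv_0_lt_compat.
have [u [v [u01 [v01 [nu [nv dd]]]]]] := NNPP _ (Hd _ _ (nb i (ltnW iN)) (nb j (ltnW jN))).
exists (fun p => exists s t, [/\ 0 <= s <= 1, 0 <= t <= 1,
      Rabs (s - u) < 2 * delta (u,v), Rabs (t - v) < 2 * delta (u,v) & p = psub (f t) (e s)]).
split; first exact: Hdelta (u, v) u01 v01.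
move=> i' j' Hi Hj; exists (node N i'), (node N j').
have si := step _ _ Hi; have sj := step _ _ Hj.
case/andP: Hi => _ /leq_trans/(_ iN) iN'; case/andP: Hj => _ /leq_trans/(_ jN) jN'.
split=> //; try exact: nb.
- by move: nu si dd; split_Rabs; lra.
- by move: nv sj dd; split_Rabs; lra.
Qed.

(** Summing [crossing_antipode] along the curve makes the [lower] terms telescope to the two
    ends. *)
Lemma turning_opposite N v (e : R -> point) : (0 < N)%N ->
  (forall i : nat, (i < N)%N -> exists S, [/\ same_side S, S (psub (e (node N i)) v) &
     S (psub (e (node N i.+1)) v)]) ->
  \big[addb/false]_(0 <= j < N)
    crossing (psub v (e (node N j))) (psub v (e (node N j.+1))) =
  turning N v e (+) (lower (psub (e 0) v) (+) lower (psub (e 1) v)).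
Proof.
move=> N0 side.
have node0 : node N 0 = 0 by rewrite /node /Rdiv Rmult_0_l.
have nodeN : node N N = 1.
  by rewrite /node /Rdiv Rinv_r //; apply: not_0_INR => NE; rewrite NE in N0.
suff gen (M : nat) : (M <= N)%N ->
  \big[addb/false]_(0 <= j < M)
    crossing (psub v (e (node N j))) (psub v (e (node N j.+1))) =
  \big[addb/false]_(0 <= j < M)
    crossing (psub (e (node N j)) v) (psub (e (node N j.+1)) v) (+)
  (lower (psub (e (node N 0)) v) (+) lower (psub (e (node N M)) v)).
  by rewrite gen // node0 nodeN.
elim: M => [|M IH] MN; first by rewrite !big_geq // addbb.
rewrite !(big_nat_recr M) //= IH ?(ltnW MN) //.
have [S [sS S1 S2]] := side _ MN; rewrite (crossing_antipode sS) //.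
set a := \big[_/_]_(_ <= _ < _) _; set b := crossing _ _.
by case: a; case: b; case: (lower _); case: (lower _); case: (lower _).
Qed.

(** This is [grid_boundary] for the map [f t - e s]: two sides of the square show [f] from the ends
    of [e], the other two show the antipode of [e] seen from the ends of [f]. *)
Lemma turning_disjoint (e f : R -> point) :
  continuous_on01 e -> continuous_on01 f ->
  (forall s t, 0 <= s <= 1 -> 0 <= t <= 1 -> e s <> f t) ->
  exists N0 : nat, forall N : nat, (N0 < N)%N ->
  turning N (e 0) f (+) turning N (e 1) f =
  (turning N (f 0) e (+) (lower (psub (e 0) (f 0)) (+) lower (psub (e 1) (f 0)))) (+)
  (turning N (f 1) e (+) (lower (psub (e 0) (f 1)) (+) lower (psub (e 1) (f 1)))).
Proof.
move=> ce cf dis; have [N0 fine] := fine_grid ce cf dis.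
have dis' s t : 0 <= s <= 1 -> 0 <= t <= 1 -> f s <> e t.
  by move=> ? ? /esym; apply: dis.
have [N1 fine'] := fine_grid cf ce dis'.
exists (maxn N0 N1) => N; rewrite gtn_max => /andP[NN0 NN1].
have N_pos : (0 < N)%N by apply: leq_ltn_trans NN0.
have node0 : node N 0 = 0 by rewrite /node /Rdiv Rmult_0_l.
have nodeN : node N N = 1.
  by rewrite /node /Rdiv Rinv_r //; apply: not_0_INR => NE; rewrite NE in N_pos.
rewrite -!(turning_opposite N_pos).
- have := @grid_boundary (fun i j => psub (f (node N j)) (e (node N i))) N.
  rewrite /turning node0 nodeN; apply=> i j iN jN.
  have [S [side cell]] := fine _ NN0 _ _ iN jN.
  by exists S; split=> //; apply: cell; rewrite ?leqnn ?leqnSn.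
(* The last row of cells, [N.-1], has the node [N] among its corners, which gives [f 1]. *)
- move=> i iN; have [S [side cell]] := fine' _ NN1 N.-1 _ ltac:(by rewrite prednK) iN.
  by exists S; rewrite -nodeN; split=> //; apply: cell; rewrite ?prednK ?leqnn ?leqnSn ?leq_pred.
- move=> i iN; have [S [side cell]] := fine' _ NN1 _ _ N_pos iN.
  by exists S; rewrite -node0; split=> //; apply: cell; rewrite ?leqnn ?leqnSn.
Qed.

(** * Application to the edges of K_{3,3} *)

Lemma uniform_threshold (I : finType) (P : I -> nat -> Prop) :
  (forall x, exists N0 : nat, forall N : nat, (N0 < N)%N -> P x N) ->
  exists N : nat, forall x, P x N.
Proof.
move=> H; have [F HF] := functional_choice _ H.
by exists (\max_x F x).+1 => x; apply: HF; rewrite ltnS leq_bigmax.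
Qed.

Lemma K33_nonplanar (T : finType) (adj : rel T) (a b : nat -> T) :
  planar adj ->
  {in gtn 3%N &, injective a} -> {in gtn 3%N &, injective b} ->
  (forall i j : nat, (i < 3)%N -> (j < 3)%N -> adj (a i) (b j)) ->
  (forall i j : nat, (i < 3)%N -> (j < 3)%N -> a i <> b j) -> False.
Proof.
move=> [pos [arc [pos_inj [arcP arc_dis]]]] inj_a inj_b adj_ab neq_ab.
pose E (i j : nat) := arc (a i) (b j).
(* Disjoint edges have disjoint closed arcs; [pos_inj], [arcP] and [arc_dis] handle two ends, an end
   and an inner point, and two inner points. *)
have disE (i j k l : nat) : (i < 3)%N -> (j < 3)%N -> (k < 3)%N -> (l < 3)%N ->
    i <> k -> j <> l ->
    forall s t, 0 <= s <= 1 -> 0 <= t <= 1 -> E i j s <> E k l t.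
  move=> i3 j3 k3 l3 ik jl s t s01 t01; rewrite /E.
  have aik : a i <> a k by move/inj_a; rewrite !inE => /(_ i3 k3).
  have bjl : b j <> b l by move/inj_b; rewrite !inE => /(_ j3 l3).
  have [_ _ e0 e1 eV] := arcP _ _ (adj_ab i j i3 j3).
  have [_ _ f0 f1 fV] := arcP _ _ (adj_ab k l k3 l3).
  have cases r : 0 <= r <= 1 -> [\/ r = 0, r = 1 | 0 < r < 1].
    move=> ?; case: (Req_dec r 0) => [|?]; first by constructor 1.
    by case: (Req_dec r 1) => [|?]; [constructor 2|constructor 3; lra].
  case: (cases _ t01) => [->|->|tI]; rewrite ?f0 ?f1.
  - case: (cases _ s01) => [->|->|sI]; rewrite ?e0 ?e1; last exact: eV.
      by move/pos_inj.
    by move/pos_inj/esym; apply: neq_ab.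
  - case: (cases _ s01) => [->|->|sI]; rewrite ?e0 ?e1; last exact: eV.
      by move/pos_inj; apply: neq_ab.
    by move/pos_inj.
  - case: (cases _ s01) => [->|->|sI]; rewrite ?e0 ?e1; try by move/esym; apply: fV.
    apply: (arc_dis _ _ _ _ (adj_ab i j i3 j3) (adj_ab k l k3 l3)) => //.
    by case=> [[]|[/(neq_ab i l i3 l3)]].
have [N HN] : exists N : nat, forall x : ('I_3 * 'I_3) * ('I_3 * 'I_3),
    x.1.1 <> x.2.1 -> x.1.2 <> x.2.2 ->
    let e := E x.1.1 x.1.2 in let f := E x.2.1 x.2.2 in
  turning N (e 0) f (+) turning N (e 1) f =
  (turning N (f 0) e (+) (lower (psub (e 0) (f 0)) (+) lower (psub (e 1) (f 0)))) (+)
  (turning N (f 1) e (+) (lower (psub (e 0) (f 1)) (+) lower (psub (e 1) (f 1)))).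
  apply: uniform_threshold => -[[[i i3] [j j3]] [[k k3] [l l3]]] /=.
  case: (classic (i <> k /\ j <> l)) => [[ik jl]|n]; last first.
    exists 0%N => N _ ik jl; case: n.
    by split=> eq; [apply: ik|apply: jl]; apply/val_inj.
  have [ce _ _ _ _] := arcP _ _ (adj_ab i j i3 j3).
  have [cf _ _ _ _] := arcP _ _ (adj_ab k l k3 l3).
  have [N0 HN0] := turning_disjoint ce cf (disE _ _ _ _ i3 j3 k3 l3 ik jl).
  by exists N0 => N /HN0.
have E01 (i j : nat) : (i < 3)%N -> (j < 3)%N -> E i j 0 = pos (a i) /\ E i j 1 = pos (b j).
  by move=> i3 j3; have [_ _ ? ? _] := arcP _ _ (adj_ab i j i3 j3).
apply: (@K33_parity (fun m i j => turning N (pos (a m)) (E i j))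
  (fun m i j => turning N (pos (b m)) (E i j))
  (fun i k => lower (psub (pos (a i)) (pos (a k))))
  (fun j k => lower (psub (pos (b j)) (pos (a k))))
  (fun i l => lower (psub (pos (a i)) (pos (b l))))
  (* Out of range, [j < l] supplies the antisymmetry that [K33_parity] requires for all distinct
     indices. *)
  (fun j l => if (j < 3)%N && (l < 3)%N then lower (psub (pos (b j)) (pos (b l)))
              else (j < l)%N)).
- move=> j l jl; rewrite andbC; case: ifP => [/andP[l3 j3]|_].
    by apply: lower_sub => /pos_inj/inj_b; rewrite !inE => /(_ j3 l3).
  by case: ltngtP jl.
- move=> i j k l /andP[ik k3] j3 l3 jl.
  have i3 := ltn_trans ik k3.
  have := HN (((Ordinal i3), (Ordinal j3)), ((Ordinal k3), (Ordinal l3))) => /=.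
  have [-> ->] := E01 _ _ i3 j3; have [-> ->] := E01 _ _ k3 l3.
  rewrite j3 l3; apply; last by case.
  by case=> e; rewrite e ltnn in ik.
Qed.

(** * Private regions *)

Definition pset := R -> R -> Prop.
Definition transp (A : pset) : pset := fun x y => A y x.
Definition disjoint_psets (A B : pset) : Prop := forall x y, A x y -> B x y -> False.
Definition sub_pset (A B : pset) : Prop := forall x y, A x y -> B x y.
Definition meets (A B : pset) : Prop := exists x y, A x y /\ B x y.
Definition Lset (L : Lshape) : pset := fun x y => in_Lshape L (x, y).

Definition hook (x0 x1 x2 y0 y1 y2 : R) : pset := fun x y =>
  (x0 <= x <= x1 /\ y0 <= y <= y2) \/ (x0 <= x <= x2 /\ y0 <= y <= y1).

(* [A] is a thick L.  [P] runs horizontally along its lower arm and crosses the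
   vertical [S] at the end of that arm; [Q] crosses the upright arm above [P]. *)
Inductive hook_pattern (A P Q S : pset) : Prop :=
  HookPattern x0 x1 xs x2 y0 yp y1 yq y2 of
    x0 < x1 /\ x1 < xs /\ xs < x2 &
    y0 < yp /\ yp < y1 /\ y1 < yq /\ yq < y2 &
    (forall x y, A x y <-> hook x0 x1 x2 y0 y1 y2 x y) &
    (forall x y, A x y -> P x y -> y = yp) &
    (forall x y, A x y -> Q x y -> y = yq) &
    (forall x y, A x y -> S x y -> x = xs) &
    (forall x, x0 <= x <= x2 -> P x yp) &
    (forall x, x0 <= x <= x1 -> Q x yq) &
    (forall y, y0 <= y <= y1 -> S xs y).

Definition box (x0 x1 y0 y1 : R) : pset := fun x y => x0 <= x <= x1 /\ y0 <= y <= y1.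

(* Three verticals enter a box from below; [Q] and then [P] end inside it, [S]
   traverses it.  Only the outer face needs this pattern. *)
Inductive strip_pattern (A P Q S : pset) : Prop :=
  StripPattern x0 xp xq xs x1 y0 tq tp y1 of
    x0 < xp /\ xp < xq /\ xq < xs /\ xs < x1 &
    y0 < tq /\ tq < tp /\ tp < y1 &
    (forall x y, A x y <-> box x0 x1 y0 y1 x y) &
    (forall x y, A x y -> P x y -> x = xp /\ y <= tp) &
    (forall x y, A x y -> Q x y -> x = xq /\ y <= tq) &
    (forall x y, A x y -> S x y -> x = xs) &
    (forall y, y0 <= y <= tp -> P xp y) &
    (forall y, y0 <= y <= tq -> Q xq y) &
    (forall y, y0 <= y <= y1 -> S xs y).

Definition pattern (A P Q S : pset) : Prop :=
  hook_pattern A P Q S \/ strip_pattern A P Q S.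

(** Reflection in the diagonal preserves the rotation of an L-shape, so each pattern may occur in
    both orientations. *)
Definition private_ordered (A P Q S : pset) : Prop :=
  pattern A P Q S \/ pattern (transp A) (transp P) (transp Q) (transp S).

Definition private_region (A P Q S : pset) : Prop :=
  private_ordered A P Q S \/ private_ordered A P S Q \/ private_ordered A Q P S \/
  private_ordered A Q S P \/ private_ordered A S P Q \/ private_ordered A S Q P.

(** [L] is the shape of a vertex stacked into the triangle, and [APQ], [APS], [AQS] serve the three
    new faces; each must avoid the old shape that its face omits. *)
Definition insertable (A P Q S : pset) : Prop :=
  exists L APQ APS AQS,
    Lshape_valid L /\ sub_pset (Lset L) A /\
    (meets (Lset L) P /\ meets (Lset L) Q /\ meets (Lset L) S) /\
    (sub_pset APQ A /\ sub_pset APS A /\ sub_pset AQS A) /\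
    (disjoint_psets APQ APS /\ disjoint_psets APQ AQS /\ disjoint_psets APS AQS) /\
    (disjoint_psets APQ S /\ disjoint_psets APS Q /\ disjoint_psets AQS P) /\
    (private_region APQ (Lset L) P Q /\ private_region APS (Lset L) P S /\
     private_region AQS (Lset L) Q S).

(** * Inserting an L-shape into a private region *)

Lemma betweenP (x y : R) : x < y -> exists z, x < z /\ z < y.
Proof. by move=> xy; exists ((x + y) / 2); lra. Qed.

Ltac regions :=
  repeat match goal with X := _ |- _ => subst X end;
  rewrite /sub_pset /disjoint_psets /box /hook /transp /Lset /in_Lshape /=;
  intros; try lra.

(** The new corner lies in the elbow of the thick L, below [P]: the upright arm crosses [P] and [Q],
    the lower arm [S]. [C] follows [P] across the new upright arm and rises to its left through [Q];
    [D] follows the new lower arm through [S], with its own upright arm through [P]; [B] stays above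
    [P], rising to [Q] and reaching right to [S]. *)
Lemma hook_insertable A P Q S : hook_pattern A P Q S -> insertable A P Q S.
Proof.
case=> x0 x1 xs x2 y0 yp y1 yq y2 [x01 [x1s xs2]] [y0p [yp1 [y1q yq2]]] EA AP AQ AS PA QA SA.
(* The order is [x0 < c1 < b0 < cx < c2 < a0 < a1 < x1 < xs < tx < x2] and [y0 < e0 < cy < e1 < yp <
   e2 < e3 < e4 < y1 < yq < ty < y2]. *)
have [cx [x0c cx1]] := betweenP x01.
have [b0 [x0b b0c]] := betweenP x0c; have [c1 [x0c1 c1b]] := betweenP x0b.
have [a0 [ca0 a01]] := betweenP cx1; have [c2 [cc2 c2a]] := betweenP ca0.
have [a1 [a0a a11]] := betweenP a01.
have [tx [stx txx]] := betweenP xs2.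
have [cy [y0c cyp]] := betweenP y0p.
have [e0 [y0e e0c]] := betweenP y0c; have [e1 [ce1 e1p]] := betweenP cyp.
have [e3 [pe3 e31]] := betweenP yp1; have [e2 [pe2 e23]] := betweenP pe3.
have [e4 [e34 e41]] := betweenP e31.
have [ty [qty tyy]] := betweenP yq2.
pose L := Build_Lshape cx cy (ty - cy) (tx - cx).
have sL : sub_pset (Lset L) A by move=> x y; rewrite EA; regions.
pose C := hook x0 c1 c2 e1 e2 y2; pose B := hook b0 c2 x2 e3 e4 ty.
pose D := hook a0 a1 tx e0 e1 e2.
have sC : sub_pset C A by move=> x y; rewrite EA; regions.
have sB : sub_pset B A by move=> x y; rewrite EA; regions.
have sD : sub_pset D A by move=> x y; rewrite EA; regions.
exists L, C, D, B.
split; first by rewrite /Lshape_valid /=; lra.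
split=> //; split.
  split; first by exists cx, yp; split; [regions|apply: PA; lra].
  split; first by exists cx, yq; split; [regions|apply: QA; lra].
  by exists xs, cy; split; [regions|apply: SA; lra].
split=> //; split; first by split; [|split]; regions.
split.
  split; [|split].
  - by move=> x y Cxy /(AS _ _ (sC _ _ Cxy)); move: Cxy; regions.
  - by move=> x y Dxy /(AQ _ _ (sD _ _ Dxy)); move: Dxy; regions.
  - by move=> x y Bxy /(AP _ _ (sB _ _ Bxy)); move: Bxy; regions.
split; [|split].
- do 3 right; left; left; left.
  apply: (@HookPattern _ _ _ _ x0 c1 cx c2 e1 yp e2 yq y2) => //; try by regions.
  + by move=> x y /sC; apply: AP.
  + by move=> x y /sC; apply: AQ.
  + by move=> x ?; apply: PA; lra.
  + by move=> x ?; apply: QA; lra.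
- left; left; left.
  apply: (@HookPattern _ _ _ _ a0 a1 xs tx e0 cy e1 yp e2) => //; try by regions.
  + by move=> x y /sD; apply: AP.
  + by move=> x y /sD; apply: AS.
  + by move=> x ?; apply: PA; lra.
  + by move=> x ?; apply: SA; lra.
(* [B] is a reflected hook: the new shape takes the role of [P], [S] that of [Q], and [Q] that of
   [S]. *)
- right; left; right; left.
  apply: (@HookPattern _ _ _ _ e3 e4 yq ty b0 cx c2 xs x2) => //; try by regions.
  + by move=> x y /sB; apply: AS.
  + by move=> x y /sB; apply: AQ.
  + by move=> y ?; apply: SA; lra.
  + by move=> x ?; apply: QA; lra.
Qed.

(** The new shape starts left of the three verticals, crosses them below the end of [Q] and rises
    past the end of [P]. Above the end of [Q], the shapes [L], [P], [S] form a strip again; the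
    other two faces get reflected hooks around the new lower arm. *)
Lemma strip_insertable A P Q S : strip_pattern A P Q S -> insertable A P Q S.
Proof.
case=> x0 xp xq xs x1 y0 tq tp y1 [x0p [xpq [xqs xs1]]] [y0q [tqp tp1]] EA AP AQ AS PA QA SA.
(* The order is [x0 < cx < b0 < xp < b1 < d0 < xq < b2 < xs < tx < x1] and [y0 < e0 < e1 < e2 < cy <
   e3 < tq < f0 < tp < ty < y1]. *)
have [cx [x0c cxp]] := betweenP x0p; have [b0 [cb0 b0p]] := betweenP cxp.
have [d0 [pd0 d0q]] := betweenP xpq; have [b1 [pb1 b1d]] := betweenP pd0.
have [b2 [qb2 b2s]] := betweenP xqs.
have [tx [stx txx]] := betweenP xs1.
have [cy [y0c cyq]] := betweenP y0q; have [e0 [y0e e0c]] := betweenP y0c.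
have [e1 [e01 e1c]] := betweenP e0c; have [e2 [e12 e2c]] := betweenP e1c.
have [e3 [ce3 e3q]] := betweenP cyq.
have [f0 [qf0 f0p]] := betweenP tqp; have [ty [pty tyy]] := betweenP tp1.
pose L := Build_Lshape cx cy (ty - cy) (tx - cx).
have sL : sub_pset (Lset L) A by move=> x y; rewrite EA; regions.
pose B := hook b0 b1 b2 y0 e0 e3; pose C := hook d0 b2 x1 e1 e2 e3.
pose D := box x0 x1 f0 y1.
have sC : sub_pset C A by move=> x y; rewrite EA; regions.
have sB : sub_pset B A by move=> x y; rewrite EA; regions.
have sD : sub_pset D A by move=> x y; rewrite EA; regions.
exists L, B, D, C.
split; first by rewrite /Lshape_valid /=; lra.
split=> //; split.
  split; first by exists xp, cy; split; [regions|apply: PA; lra].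
  split; first by exists xq, cy; split; [regions|apply: QA; lra].
  by exists xs, cy; split; [regions|apply: SA; lra].
split=> //; split; first by split; [|split]; regions.
split.
  split; [|split].
  - by move=> x y Cxy /(AS _ _ (sB _ _ Cxy)); move: Cxy; regions.
  - by move=> x y Dxy /(AQ _ _ (sD _ _ Dxy)); move: Dxy; regions.
  - by move=> x y Bxy /(AP _ _ (sC _ _ Bxy)); move: Bxy; regions.
split; [|split].
- do 3 right; left; right; left.
  apply: (@HookPattern _ _ _ _ y0 e0 cy e3 b0 xp b1 xq b2) => //; try by regions.
  + by move=> x y /sB; rewrite /transp=> H /(AP _ _ H) [].
  + by move=> x y /sB; rewrite /transp=> H /(AQ _ _ H) [].
  + by move=> x ?; apply: PA; lra.
  + by move=> x ?; apply: QA; lra.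
- left; left; right.
  apply: (@StripPattern _ _ _ _ x0 cx xp xs x1 f0 tp ty y1) => //; try by regions.
  + by move=> x y /sD; apply: AP.
  + by move=> x y /sD; apply: AS.
  + by move=> x ?; apply: PA; lra.
  + by move=> x ?; apply: SA; lra.
- do 3 right; left; right; left.
  apply: (@HookPattern _ _ _ _ e1 e2 cy e3 d0 xq b2 xs x1) => //; try by regions.
  + by move=> x y /sC; rewrite /transp=> H /(AQ _ _ H) [].
  + by move=> x y /sC; rewrite /transp=> H /(AS _ _ H).
  + by move=> x ?; apply: QA; lra.
  + by move=> x ?; apply: SA; lra.
Qed.

Lemma private_swap12 A P Q S : private_region A P Q S -> private_region A Q P S.
Proof. by rewrite /private_region; tauto. Qed.

Lemma private_swap23 A P Q S : private_region A P Q S -> private_region A P S Q.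
Proof. by rewrite /private_region; tauto. Qed.

Lemma private_transp A P Q S :
  private_region (transp A) (transp P) (transp Q) (transp S) -> private_region A P Q S.
Proof.
have ord B P' Q' S' : private_ordered (transp B) (transp P') (transp Q') (transp S') ->
    private_ordered B P' Q' S' by case; [right|left].
by case=> [|[|[|[|[|]]]]] /ord; rewrite /private_region; tauto.
Qed.

Lemma insertable_swap12 A P Q S : insertable A P Q S -> insertable A Q P S.
Proof.
move=> [L [X [Y [Z [vL [sL [mL [sub [[d1 [d2 d3]] [dis [pX [pY pZ]]]]]]]]]]]].
exists L, X, Z, Y; do 3 (split; first by tauto); split; first by tauto.
split; first by split=> //; split=> // x y ? ?; apply: (d3 x y).
by split; [tauto|split; [exact: private_swap23|]].
Qed.

Lemma insertable_swap23 A P Q S : insertable A P Q S -> insertable A P S Q.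
Proof.
move=> [L [X [Y [Z [vL [sL [mL [sub [[d1 [d2 d3]] [dis [pX [pY pZ]]]]]]]]]]]].
exists L, Y, X, Z; do 3 (split; first by tauto); split; first by tauto.
split; first by split=> [x y ? ?|//]; apply: (d1 x y).
by split; [tauto|do 2 (split=> //); exact: private_swap23].
Qed.

Definition Ltransp (L : Lshape) : Lshape := Build_Lshape (Ly L) (Lx L) (Lw L) (Lh L).

Lemma Lset_transp L x y : Lset (Ltransp L) x y <-> Lset L y x.
Proof. by rewrite /Lset /in_Lshape /=; tauto. Qed.

Lemma private_ext A P P' Q S : (forall x y, P x y <-> P' x y) ->
  private_region A P Q S -> private_region A P' Q S.
Proof.
move=> E; suff -> : P' = P by [].
by apply: functional_extensionality => x; apply: functional_extensionality => y;
  apply: propositional_extensionality; split=> /E.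
Qed.

Lemma insertable_transp A P Q S :
  insertable (transp A) (transp P) (transp Q) (transp S) -> insertable A P Q S.
Proof.
have mt L B : meets (Lset L) (transp B) -> meets (Lset (Ltransp L)) B.
  by move=> [x [y [Lxy Bxy]]]; exists y, x; split=> //; apply/Lset_transp.
have pt X L B C : private_region X (Lset L) (transp B) (transp C) ->
    private_region (transp X) (Lset (Ltransp L)) B C.
  move=> H; apply: (@private_ext _ (transp (Lset L))); last exact: private_transp.
  by move=> x y; rewrite Lset_transp.
move=> [L [X [Y [Z [[v1 v2] [sL [[m1 [m2 m3]] [[s1 [s2 s3]]
  [[d1 [d2 d3]] [[e1 [e2 e3]] [pX [pY pZ]]]]]]]]]]]].
exists (Ltransp L), (transp X), (transp Y), (transp Z).
split; first by split.
split; first by move=> x y /Lset_transp /sL.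
split; first by split; [|split]; apply: mt.
split; first by split; [|split] => x y; [apply: s1|apply: s2|apply: s3].
split; first by split; [|split] => x y; [apply: d1|apply: d2|apply: d3].
split; first by split; [|split] => x y; [apply: e1|apply: e2|apply: e3].
by split; [|split]; apply: pt.
Qed.

Lemma private_region_insertable A P Q S : private_region A P Q S -> insertable A P Q S.
Proof.
have pat B P' Q' S' : pattern B P' Q' S' -> insertable B P' Q' S'.
  by case; [exact: hook_insertable|exact: strip_insertable].
have ord B P' Q' S' : private_ordered B P' Q' S' -> insertable B P' Q' S'.
  by case=> [|?]; [exact: pat|apply: insertable_transp; exact: pat].
case=> [|[|[|[|[|]]]]] /ord H //.
- exact: insertable_swap23.
- exact: insertable_swap12.
- by apply: insertable_swap12; apply: insertable_swap23.
- by apply: insertable_swap23; apply: insertable_swap12.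
- by apply: insertable_swap12; apply: insertable_swap23; apply: insertable_swap12.
Qed.

(** * Growing the representation *)

Local Open Scope nat_scope.

Definition common_nbrs (T : finType) (adj : rel T) (V A : {set T}) : {set T} :=
  [set w in V | [forall x in A, adj w x]].

(* Each triangle [A] has two slots [(A, true)] and [(A, false)] for private regions,
   because the initial triangle bounds two faces; [act] tells which are in use. *)
Record drawing (T : finType) (adj : rel T) (V : {set T}) (f : T -> Lshape)
    (act : {set T} -> bool -> bool) (reg : {set T} -> bool -> pset) : Prop := Drawing {
  drawing_valid : forall v, Lshape_valid (f v);
  drawing_adj : forall u v, u \in V -> v \in V -> u != v ->
    (adj u v <-> meets (Lset (f u)) (Lset (f v)));
  drawing_private : forall A b, act A b -> exists x y z, [/\ A = [set x; y; z], A \subset V &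
    private_region (reg A b) (Lset (f x)) (Lset (f y)) (Lset (f z))];
  drawing_avoid : forall A b v, act A b -> v \in V -> v \notin A ->
    disjoint_psets (reg A b) (Lset (f v));
  drawing_disjoint : forall A b A' b', act A b -> act A' b' -> (A, b) != (A', b') ->
    disjoint_psets (reg A b) (reg A' b');
  drawing_avail : forall A : {set T}, A \subset V -> #|A| = 3 ->
    {in A &, forall x y, x != y -> adj x y} ->
    2 <= act A true + act A false + #|common_nbrs adj V A| }.

(** Three common neighbours together with [A] would span a K_{3,3}. *)
Lemma common_nbrs_le2 (T : finType) (adj : rel T) (V A : {set T}) :
  planar adj -> irreflexive adj -> #|A| = 3 -> #|common_nbrs adj V A| <= 2.
Proof.
move=> pl irr A3; rewrite leqNgt; apply/negP => C3.
have [v0 _] : exists v, v \in A by apply/set0Pn; rewrite -card_gt0 A3.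
pose w i := nth v0 (enum (common_nbrs adj V A)) i; pose a i := nth v0 (enum A) i.
have ltC (i : nat) : i < 3 -> i < size (enum (common_nbrs adj V A)).
  by move=> i3; rewrite -cardE (leq_trans i3).
have ltA (i : nat) : i < 3 -> i < size (enum A) by rewrite -cardE A3.
have adjwa (i j : nat) : i < 3 -> j < 3 -> adj (w i) (a j).
  move=> /ltC/(mem_nth v0); rewrite mem_enum inE => /andP[_ /forall_inP adjA] /ltA/(mem_nth v0).
  by rewrite mem_enum => /adjA.
apply: (K33_nonplanar pl (a := w) (b := a)) => //.
- move=> i j; rewrite !inE => /ltC i3 /ltC j3 /eqP.
  by rewrite nth_uniq ?enum_uniq // => /eqP.
- move=> i j; rewrite !inE => /ltA i3 /ltA j3 /eqP.
  by rewrite nth_uniq ?enum_uniq // => /eqP.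
- by move=> i j i3 j3 e; have := adjwa _ _ i3 j3; rewrite e irr.
Qed.

(** The new regions are indexed by the vertex [r] of the old triangle that the new face omits. *)
Lemma insert_in_region (T : finType) (f : T -> Lshape) R (x y z : T) (N := [set x; y; z]) :
  #|N| = 3 -> private_region R (Lset (f x)) (Lset (f y)) (Lset (f z)) ->
  exists L (Rg : T -> pset), [/\ Lshape_valid L, sub_pset (Lset L) R,
    {in N &, forall r r', r != r' -> disjoint_psets (Rg r) (Rg r')} &
    {in N, forall r, [/\ meets (Lset L) (Lset (f r)), sub_pset (Rg r) R,
      disjoint_psets (Rg r) (Lset (f r)) &
      exists p q, N :\ r = [set p; q] /\
        private_region (Rg r) (Lset L) (Lset (f p)) (Lset (f q))]}].
Proof.
move=> N3 /private_region_insertable.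
move=> [L [X [Y [Z [vL [sL [[m1 [m2 m3]] [[s1 [s2 s3]]
  [[d1 [d2 d3]] [[e1 [e2 e3]] [pX [pY pZ]]]]]]]]]]]].
have [/negPf xy [/negPf xz /negPf yz]] : x != y /\ x != z /\ y != z.
  move: N3; rewrite /N setUC cardsU1 cards2 !inE (eq_sym z x) (eq_sym z y).
  by case: (x == y); case: (x == z); case: (y == z).
have dsym A B : disjoint_psets A B -> disjoint_psets B A.
  by move=> AB u v ? ?; apply: (AB u v).
exists L, (fun r => if r == z then X else if r == y then Y else Z).
have inN r : r \in N -> [\/ r = x, r = y | r = z].
  by rewrite !inE -orbA => /or3P[]/eqP ->; [constructor 1|constructor 2|constructor 3].
split=> //.
- move=> r r' /inN[] -> /inN[] ->; rewrite ?eqxx ?xy ?xz ?yz // => _; do ?[by []|exact: dsym].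
- move=> r /inN[] ->; rewrite ?eqxx ?xy ?xz ?yz; split=> //.
  + exists y, z; split=> //; apply/setP => u; rewrite !inE.
    by have [->|] := eqVneq u x; rewrite ?xy ?xz.
  + exists x, z; split=> //; apply/setP => u; rewrite !inE.
    by have [->|] := eqVneq u y; rewrite /= ?(eq_sym y x) ?xy ?yz ?orbF.
  + exists x, y; split=> //; apply/setP => u; rewrite !inE.
    by have [->|] := eqVneq u z; rewrite /= ?(eq_sym z x) ?(eq_sym z y) ?xz ?yz ?orbF.
Qed.

(** The new vertex uses up one slot of [N], and each triangle formed by [v] and an edge of [N] gains
    one. *)
Lemma drawing_extend (T : finType) (adj : rel T) (V : {set T}) f act reg v
    (N := [set y in V | adj v y]) :
  planar adj -> simple_graph adj -> drawing adj V f act reg -> v \notin V ->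
  #|N| = 3 -> {in N &, forall x y, x != y -> adj x y} ->
  exists f' act' reg', drawing adj (v |: V) f' act' reg'.
Proof.
move=> pl [adjC irr] [Hval Hadj Hpriv Havoid Hdis Havail] vV N3 clN.
have NE u : (u \in N) = (u \in V) && adj v u by rewrite inE.
clearbody N; have NV : N \subset V by apply/subsetP => u; rewrite NE => /andP[].
have vN : v \notin N by apply: contra vV; apply: (subsetP NV).
(* Counting [v], the triangle [N] has at most two common neighbours, hence at most one in [V], so
   [drawing_avail] leaves an active slot. *)
have [b actb] : exists b, act N b.
  have := Havail N NV N3 clN.
  have : #|v |: common_nbrs adj V N| <= 2.
    apply: leq_trans (common_nbrs_le2 (v |: V) pl irr N3); apply: subset_leq_card.
    apply/subsetP => u; rewrite !inE => /orP[/eqP ->|/andP[-> ->]]; last by rewrite orbT.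
    by rewrite eqxx; apply/forall_inP => w; rewrite NE => /andP[].
  rewrite cardsU1 inE (negPf vV) /= add1n ltnS.
  case E1: (act N true); first by exists true.
  case E2: (act N false); first by exists false.
  by rewrite !add0n => le1 /leq_trans/(_ le1).
have [x [y [z [EN _ privN]]]] := Hpriv _ _ actb.
have [L [Rg [vL sL disRg HRg]]] : exists L (Rg : T -> pset),
    [/\ Lshape_valid L, sub_pset (Lset L) (reg N b),
    {in N &, forall r r', r != r' -> disjoint_psets (Rg r) (Rg r')} &
    {in N, forall r, [/\ meets (Lset L) (Lset (f r)), sub_pset (Rg r) (reg N b),
      disjoint_psets (Rg r) (Lset (f r)) &
      exists p q, N :\ r = [set p; q] /\
        private_region (Rg r) (Lset L) (Lset (f p)) (Lset (f q))]}].
  by rewrite EN; apply: insert_in_region; rewrite -?EN.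
pose f' u := if u == v then L else f u.
pose act' (A : {set T}) (b' : bool) :=
  if v \in A then b' && [exists r in N, A == v |: (N :\ r)]
  else act A b' && ((A, b') != (N, b)).
(* For an active [A] through [v], the only vertex of [N :\: A] is the omitted one; the empty default
   is never reached by an active slot. *)
pose reg' (A : {set T}) (b' : bool) : pset :=
  if v \in A then (if [pick r in N :\: A] is Some r then Rg r else fun _ _ => False)
  else reg A b'.
have f'v : f' v = L by rewrite /f' eqxx.
have f'V u : u \in V -> f' u = f u.
  by rewrite /f'; case: eqP => // -> vV'; rewrite vV' in vV.
have actv (A : {set T}) b' : v \in A -> act' A b' ->
    b' /\ exists r, [/\ r \in N, A = v |: (N :\ r), r \notin A & reg' A b' = Rg r].
  rewrite /act' /reg' => vA; rewrite vA => /andP[-> /exists_inP[r rN /eqP EA]]; split=> //.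
  have rA : r \notin A.
    by rewrite EA !inE eqxx orbF; apply: contraNneq vN => <-.
  exists r; split=> //; case: pickP => [r'|/(_ r)]; last by rewrite inE rA rN.
  rewrite EA !inE negb_or negb_and negbK => /andP[/andP[_ /orP[/eqP ->//|]]].
  by move=> nr' r'N; rewrite r'N in nr'.
have actnv (A : {set T}) b' : v \notin A -> act' A b' ->
    [/\ act A b', (A, b') != (N, b) & reg' A b' = reg A b'].
  by rewrite /act' /reg' => /negPf -> /andP[].
have dsym A B : disjoint_psets A B -> disjoint_psets B A.
  by move=> AB u w ? ?; apply: (AB u w).
exists f', act', reg'; split.
- by move=> u; rewrite /f'; case: eqP.
(* A vertex of [V] outside [N] has a shape that avoids the old region, hence also [L], which lies
   inside it. *)
- have new w : w \in V -> adj v w <-> meets (Lset L) (Lset (f w)).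
    move=> wV; have [wN|wN] := boolP (w \in N).
      by have [mw _ _ _] := HRg _ wN; split=> // _; move: wN; rewrite NE => /andP[].
    split=> [avw|[p [q [Lpq fpq]]]]; first by rewrite NE wV avw in wN.
    by case: (Havoid _ _ _ actb wV wN p q (sL _ _ Lpq) fpq).
  have msym A B : meets A B -> meets B A by move=> [p [q []]]; exists p, q.
  move=> u w; rewrite !inE => /orP[/eqP ->|uV] /orP[/eqP ->|wV]; rewrite ?eqxx // ?f'v => uw.
  + by rewrite f'V //; apply: new.
  + by rewrite f'V // adjC; split=> [/(new _ uV)|/msym/(new _ uV)//]; apply: msym.
  + by rewrite !f'V //; apply: Hadj.
- move=> A b' aA; have [vA|vA] := boolP (v \in A).
    have [_ [r [rN EA _ ->]]] := actv _ _ vA aA.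
    have [_ _ _ [p [q [Epq priv]]]] := HRg _ rN.
    have sub : N :\ r \subset V by apply: subset_trans NV; apply: subsetDl.
    have pV : p \in V by apply: (subsetP sub); rewrite Epq !inE eqxx.
    have qV : q \in V by apply: (subsetP sub); rewrite Epq !inE eqxx orbT.
    exists v, p, q; rewrite f'v !f'V //; split=> //.
      by rewrite EA Epq setUA.
    by rewrite EA setUS.
  have [aA' _ ->] := actnv _ _ vA aA.
  have [x' [y' [z' [EA sA priv]]]] := Hpriv _ _ aA'.
  exists x', y', z'; split=> //; first by apply: subset_trans sA _; apply: subsetUr.
  by rewrite !f'V //; apply: (subsetP sA); rewrite EA !inE eqxx ?orbT.
- move=> A b' u aA uV uA; have [vA|vA] := boolP (v \in A).
    have [_ [r [rN EA rA ->]]] := actv _ _ vA aA.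
    have [_ sub dr _] := HRg _ rN.
    have uv : u != v by apply: contraNneq uA => ->.
    have {}uV : u \in V by move: uV; rewrite !inE (negPf uv).
    rewrite f'V //; have [uN|uN] := boolP (u \in N).
      (* Among the vertices of [N] only the omitted [r] lies outside [A]. *)
      suff -> : u = r by [].
      by apply/eqP; apply: contraNT uA => ur; rewrite EA !inE ur uN orbT.
    by move=> p q /sub; apply: (Havoid _ _ _ actb).
  have [aA' neq ->] := actnv _ _ vA aA.
  have [->|uv] := eqVneq u v.
    by rewrite f'v => p q Apq /sL; apply: (Hdis _ _ _ _ aA' actb neq) Apq.
  have {}uV : u \in V by move: uV; rewrite !inE (negPf uv).
  by rewrite f'V //; apply: Havoid.
- have mixed (A : {set T}) b1 (B : {set T}) b2 :
      v \in A -> act' A b1 -> v \notin B -> act' B b2 ->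
      disjoint_psets (reg' A b1) (reg' B b2).
    move=> vA aA vB aB.
    have [_ [r [rN _ _ ->]]] := actv _ _ vA aA.
    have [aB' neq ->] := actnv _ _ vB aB.
    have [_ sub _ _] := HRg _ rN.
    by move=> p q /sub; apply: (dsym _ _ (Hdis _ _ _ _ aB' actb neq)).
  move=> A b1 B b2 aA aB neq.
  have [vA|vA] := boolP (v \in A); have [vB|vB] := boolP (v \in B).
  + have [b1T [r [rN EA _ ->]]] := actv _ _ vA aA.
    have [b2T [r' [rN' EB _ ->]]] := actv _ _ vB aB.
    apply: disRg => //; apply: contraNneq neq => rr.
    by rewrite EA EB rr b1T b2T.
  + exact: mixed.
  + by apply: dsym; apply: mixed.
  + have [aA' _ ->] := actnv _ _ vA aA; have [aB' _ ->] := actnv _ _ vB aB.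
    exact: Hdis.
- move=> A AV A3 clA; have [vA|vA] := boolP (v \in A).
    have sAN : A :\ v \subset N.
      apply/subsetP => u; rewrite !inE => /andP[uv uA].
      have := subsetP AV _ uA; rewrite !inE NE (negPf uv) /= => ->.
      by apply: clA => //; rewrite eq_sym.
    (* The third vertex [r] of [N] is a common neighbour of [A]; with the slot [true] this makes
       two. *)
    have [r rNA] : exists r, r \in N :\: (A :\ v).
      apply/set0Pn; rewrite -card_gt0 cardsDS // N3.
      by have := cardsD1 v A; rewrite vA A3 add1n => -[<-].
    have [rN rA] : r \in N /\ r \notin A :\ v by move: rNA; rewrite inE => /andP[].
    have EAv : A :\ v = N :\ r.
      apply/eqP; rewrite eqEcard; apply/andP; split.
        apply/subsetP => u uA; rewrite in_setD1 (subsetP sAN _ uA) andbT.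
        by apply: contraNneq rA => <-.
      have := cardsD1 v A; rewrite vA A3 add1n => -[<-].
      by have := cardsD1 r N; rewrite rN N3 add1n => -[<-].
    have EA : A = v |: (N :\ r) by rewrite -EAv setD1K.
    have -> : act' A true by rewrite /act' vA; apply/exists_inP; exists r => //; rewrite EA.
    rewrite -addnA add1n ltnS; apply: leq_trans (leq_addl _ _).
    rewrite card_gt0; apply/set0Pn; exists r.
    have rV : r \in V by apply: (subsetP NV).
    rewrite 3!inE rV orbT; apply/forall_inP => u; rewrite EA in_setU1 in_setD1.
    move=> /orP[/eqP ->|/andP[ur uN]].
      by rewrite adjC; move: rN; rewrite NE => /andP[].
    by apply: clN; rewrite // eq_sym.
  have {}AV : A \subset V.
    apply/subsetP => u uA; have := subsetP AV _ uA.
    by rewrite !inE => /orP[/eqP uv|//]; rewrite -uv uA in vA.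
  have := Havail _ AV A3 clA.
  (* [N] loses the slot [b] but gains the common neighbour [v]; any other old triangle keeps its
     slots and its common neighbours. *)
  have [EA|nEA] := eqVneq A N.
    rewrite EA /act' (negPf vN) => av.
    have -> : common_nbrs adj (v |: V) N = v |: common_nbrs adj V N.
      apply/setP => u; rewrite !inE; have [->|//] := eqVneq u v.
      by apply/forall_inP => w; rewrite NE => /andP[].
    rewrite cardsU1 inE (negPf vV) /= add1n addnS -(addSn _ #|_|).
    apply: leq_trans av _; rewrite leq_add2r !xpair_eqE !eqxx /=.
    by case: b actb {privN sL HRg act' reg' actv actnv} => ->; rewrite /= ?andbT ?andbF; case: (act N _).
  move=> av; apply: leq_trans av _; rewrite /act' (negPf vA) !xpair_eqE (negPf nEA) /= !andbT.
  rewrite leq_add2l; apply: subset_leq_card; apply/subsetP => u; rewrite !inE.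
  by case/andP=> -> ->; rewrite orbT.
Qed.

(** * The initial triangle and the induction *)

Local Open Scope R_scope.

(** The shapes cross pairwise at (0,1), (2,0) and (2,1). The inner hook meets the horizontals at
    heights 0 and 1 and the vertical at 2; the outer box meets the three verticals, whose tops are
    at heights 2, 3 and 5. *)
Definition triangle_lower : Lshape := Build_Lshape 0 0 2 3.
Definition triangle_upper : Lshape := Build_Lshape (-1) 1 2 4.
Definition triangle_right : Lshape := Build_Lshape 2 (-1) 6 1.
Definition inner_region : pset := hook (/2) 1 (5/2) (-/2) (/2) (5/4).
Definition outer_region : pset := box (-2) 3 (3/2) 4.

Lemma inner_region_private : private_region inner_region
  (Lset triangle_lower) (Lset triangle_upper) (Lset triangle_right).
Proof.
left; left; left; rewrite /inner_region.
by apply: (@HookPattern _ _ _ _ (/2) 1 2 (5/2) (-/2) 0 (/2) 1 (5/4)) => //; regions.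
Qed.

Lemma outer_region_private : private_region outer_region
  (Lset triangle_lower) (Lset triangle_upper) (Lset triangle_right).
Proof.
right; right; left; left; right; rewrite /outer_region.
by apply: (@StripPattern _ _ _ _ (-2) (-1) 0 2 3 (3/2) 2 3 4) => //; regions.
Qed.

Lemma drawing_triangle (T : finType) (adj : rel T) x y z (V := [set x; y; z]) :
  #|V| = 3%N -> {in V &, forall u v, u != v -> adj u v} ->
  exists f act reg, drawing adj V f act reg.
Proof.
move=> V3 clV.
have [/negPf xy [/negPf xz /negPf yz]] : x != y /\ x != z /\ y != z.
  move: V3; rewrite /V setUC cardsU1 cards2 !inE (eq_sym z x) (eq_sym z y).
  by case: (x == y); case: (x == z); case: (y == z).
pose f u := if u == x then triangle_lower else if u == y then triangle_upper else triangle_right.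
have fx : f x = triangle_lower by rewrite /f eqxx.
have fy : f y = triangle_upper by rewrite /f eqxx eq_sym xy.
have fz : f z = triangle_right by rewrite /f !(eq_sym z) xz yz.
(* Both faces of the triangle are free, so its two active slots already satisfy [drawing_avail]. *)
exists f, (fun A _ => A == V), (fun _ b => if b then inner_region else outer_region).
split.
- by move=> v; rewrite /f /Lshape_valid; case: ifP => _ /=; first lra; case: ifP => _ /=; lra.
- have msym A B : meets A B -> meets B A by move=> [p [q []]]; exists p, q.
  have mxy : meets (Lset triangle_lower) (Lset triangle_upper) by exists 0, 1; split; regions.
  have mxz : meets (Lset triangle_lower) (Lset triangle_right) by exists 2, 0; split; regions.
  have myz : meets (Lset triangle_upper) (Lset triangle_right) by exists 2, 1; split; regions.
  move=> u v uV vV uv; split=> _; last exact: clV.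
  have inV w : w \in V -> [\/ w = x, w = y | w = z].
    by rewrite !inE -orbA => /or3P[]/eqP ->; [constructor 1|constructor 2|constructor 3].
  by case: (inV _ uV) uv => ->; case: (inV _ vV) => ->; rewrite ?eqxx // ?fx ?fy ?fz // => _; apply: msym.
- move=> A b /eqP ->; exists x, y, z; rewrite fx fy fz; split=> //.
  by case: b; [exact: inner_region_private|exact: outer_region_private].
- by move=> A b v /eqP ->  ->.
- move=> A b A' b' /eqP -> /eqP ->; rewrite xpair_eqE eqxx /=.
  by case: b; case: b' => // _; rewrite /inner_region /outer_region; regions.
- move=> A AV A3 _; suff -> : A == V by [].
  by rewrite eqEcard AV V3 A3.
Qed.

Local Open Scope nat_scope.

(** The induction starts from three vertices instead of K_4: the fourth is an ordinary insertion
    into the initial triangle. *)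
Lemma three_tree_drawing (T : finType) (adj : rel T) (s : seq T) :
  planar adj -> simple_graph adj -> uniq s -> 4 <= size s ->
  is_clique adj (take 4 s) ->
  (forall (i : nat) (x0 : T), 4 <= i < size s ->
    let nb := [seq y <- take i s | adj (nth x0 s i) y] in
    size nb = 3 /\ is_clique adj nb) ->
  forall i, 3 <= i <= size s ->
  exists f act reg, drawing adj [set x in take i s] f act reg.
Proof.
move=> pl simp us s4 cl4 nbs.
have x0 : T by case: s s4 {us cl4 nbs}.
elim=> // i IH; rewrite leq_eqVlt => /andP[/orP[/eqP [<-]|i3] ilt].
  have us3 := take_uniq 3 us.
  have cl3 : {in [set x in take 3 s] &, forall u v, u != v -> adj u v}.
    move=> u v; rewrite !inE => us' vs'; apply: cl4.
      by rewrite -(cat_take_drop 3 (take 4 s)) take_takel // mem_cat us'.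
    by rewrite -(cat_take_drop 3 (take 4 s)) take_takel // mem_cat vs'.
  have : size (take 3 s) = 3 by rewrite size_take; case: ltnP s4 => // /leq_trans h /h.
  move: cl3 us3; case: (take 3 s) => [|x [|y [|z [|]]]] // cl3 us3 _.
  have E : [set u in [:: x; y; z]] = [set x; y; z].
    by apply/setP => u; rewrite !inE orbA.
  rewrite E in cl3 *; apply: drawing_triangle => //.
  by rewrite -E cardsE; apply/card_uniqP.
have [f [act [reg D]]] := IH ltac:(by apply/andP; split; [|exact: ltnW]).
have -> : [set x in take i.+1 s] = nth x0 s i |: [set x in take i s].
  by apply/setP => u; rewrite (take_nth x0) // !inE mem_rcons inE.
have v_notin : nth x0 s i \notin take i s.
  by have := take_uniq i.+1 us; rewrite (take_nth x0) // rcons_uniq => /andP[].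
have [nb3 nbcl] : let nb := [seq y <- take i s | adj (nth x0 s i) y] in
    size nb = 3 /\ is_clique adj nb.
  (* For [i = 3] all three earlier vertices are neighbours, because [take 4 s] is a clique. *)
  move: i3; rewrite ltnS leq_eqVlt => /orP[/eqP E|i4]; last by apply: nbs; rewrite i4.
  have sub u : u \in take i s -> u \in take 4 s.
    by move=> us'; rewrite -(cat_take_drop i (take 4 s)) take_takel -?E // mem_cat E us'.
  have v4 : nth x0 s i \in take 4 s by rewrite -E (take_nth x0) ?E // mem_rcons inE -E eqxx.
  have -> : [seq y <- take i s | adj (nth x0 s i) y] = take i s.
    apply/all_filterP/allP => u us'; apply: cl4 => //; first exact: sub.
    by apply: contraNneq v_notin => ->.
  split; first by rewrite size_take ilt.
  by move=> u v /sub us' /sub vs'; apply: cl4.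
have EN : [set y in [set x in take i s] | adj (nth x0 s i) y] =
    [set y in [seq y <- take i s | adj (nth x0 s i) y]].
  by apply/setP => u; rewrite !inE mem_filter andbC.
apply: drawing_extend D _ _ _ => //; first by rewrite inE.
- by rewrite EN cardsE -nb3; apply/card_uniqP; rewrite filter_uniq // take_uniq.
- by rewrite EN => u v; rewrite !inE => uN vN; apply: nbcl; rewrite ?inE.
Qed.

Theorem theorem2 (T : finType) (adj : rel T) :
  planar_three_tree adj -> is_L_graph adj.
Proof.
move=> [[simp [s [us sT s4 cl4 nbs]]] pl].
have [f [act [reg D]]] := three_tree_drawing pl simp us s4 cl4 nbs (i := size s)
  ltac:(by rewrite leqnn ltnW).
exists f; split=> [v|u v /eqP uv]; first exact: drawing_valid D v.
have inV w : w \in [set x in take (size s) s] by rewrite inE take_size sT.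
split=> [/(drawing_adj D (inV u) (inV v) uv)|].
  by move=> [x [y Hxy]]; exists (x, y).
by move=> [[x y] Hxy]; apply/(drawing_adj D (inV u) (inV v) uv); exists x, y.
Qed.
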